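(* Let $\Bbbk$ be an algebraically closed field with $\operatorname{char}\Bbbk=p>2$, and let $\mathcal D$ be the algebra defined in the context. There are exactly $p$ isomorphism classes of simple $\mathcal D$-modules, which have dimensions $1,3,5,\dots,2p-1$.
   Context: $\mathcal D$ is the $\Bbbk$-algebra generated by $x_1,x_2,u_1,u_2,g,\zeta$ with relations (writing $x_{21}=x_2x_1+x_1x_2$, $u_{21}=u_1u_2+u_2u_1$): $x_1^2=0$, $x_2x_{21}=x_{21}x_2+x_1x_{21}$, $x_{21}^p=0$, $x_2^{2p}=0$, $u_1^2=0$, $u_2u_{21}=u_{21}u_2+u_1u_{21}$, $u_{21}^p=0$, $u_2^{2p}=0$, $\zeta^p=\zeta$, $g^p=1$, $\zeta g=g\zeta$, $\zeta x_i=x_i\zeta+x_i$, $u_i\zeta=\zeta u_i+u_i$ ($i=1,2$), $gx_1=x_1g$, $gx_2=(x_2-x_1)g$, $u_1g=gu_1$, $u_2g=gu_2-gu_1$, $u_1x_1=-x_1u_1$, $u_1x_2=-x_2u_1+(1-g)$, $u_2x_1=-x_1u_2+(1-g)+x_1u_1$, $u_2x_2=-x_2u_2+g\zeta+x_2u_1$. *)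

(* Defs.v *)
From HB Require Import structures.
From mathcomp Require Import all_boot all_order all_algebra.
From mathcomp Require Import boolp.
From mathcomp Require Import monalg.

Set Implicit Arguments.
Unset Strict Implicit.
Unset Printing Implicit Defensive.

Import GRing.Theory.
Local Open Scope ring_scope.
Local Open Scope quotient_scope.

Section TwoSidedIdeals.
Variable R : pzRingType.

Definition ideal_closed (J : {pred R}) : Prop :=
  zmod_closed J /\
  (forall a, {in J, forall u, a * u \in J /\ u * a \in J}).

(* The two-sided ideal generated by the differences l - r, (l, r) in rels. *)
Definition gen_ideal (rels : seq (R * R)) : {pred R} :=
  fun a => `[< forall J : {pred R}, ideal_closed J ->
    (forall l r, (l, r) \in rels -> l - r \in J) -> a \in J >].

Lemma gen_idealP rels a :
  reflect (forall J : {pred R}, ideal_closed J ->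
             (forall l r, (l, r) \in rels -> l - r \in J) -> a \in J)
          (a \in gen_ideal rels).
Proof. exact: asboolP. Qed.

Lemma gen_ideal_closed rels : ideal_closed (gen_ideal rels).
Proof.
split; first split.
- by apply/gen_idealP => J [[J0 _] _] _.
- move=> a b /gen_idealP Ia /gen_idealP Ib; apply/gen_idealP => J idJ rJ.
  by case: (idJ) => -[_ JB] _; apply: JB; [apply: Ia | apply: Ib].
- move=> a u /gen_idealP Iu; split; apply/gen_idealP => J idJ rJ;
    by case: (idJ) => _ JM; have [] := JM a u (Iu _ idJ rJ).
Qed.

Lemma mem_gen_ideal rels l r : (l, r) \in rels -> l - r \in gen_ideal rels.
Proof. by move=> lr; apply/gen_idealP => J _; apply. Qed.

HB.instance Definition _ rels :=
  GRing.isZmodClosed.Build R (gen_ideal rels) (gen_ideal_closed rels).1.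

End TwoSidedIdeals.

Lemma gen_ideal_ker (R S : pzRingType) (f : {rmorphism R -> S}) rels a :
  (forall l r, (l, r) \in rels -> f l = f r) -> a \in gen_ideal rels -> f a = 0.
Proof.
move=> f_rels /gen_idealP Ia.
suff /asboolP : a \in (fun b => `[< f b = 0 >] : bool) by [].
apply: Ia => [|l r /f_rels flr]; last first.
  by apply/asboolP; rewrite rmorphB flr subrr.
split; first split.
- by apply/asboolP; rewrite rmorph0.
- by move=> b c /asboolP fb /asboolP fc; apply/asboolP; rewrite rmorphB fb fc subrr.
- move=> b u /asboolP fu.
  by split; apply/asboolP; rewrite rmorphM fu ?mulr0 ?mul0r.
Qed.

Section Presented.
Variables (k : comNzRingType) (A : algType k) (rels : seq (A * A)).
Variable proper_rels : 1 \notin gen_ideal rels.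

(* The quotient of A by the ideal generated by rels. The argument proper_rels
   only serves to make it a nonzero ring, as required by nzRingType. *)
Definition presented := let _ := proper_rels in {ideal_quot gen_ideal rels}.

HB.instance Definition _ := Choice.on presented.
HB.instance Definition _ := GRing.Zmodule.on presented.

Local Notation Q := {ideal_quot gen_ideal rels}.
Implicit Types (a b : A) (x y : Q).

Definition presented_one : Q := \pi_Q 1.
Definition presented_mul x y : Q := \pi_Q (repr x * repr y).
Definition presented_scale (c : k) x : Q := \pi_Q (c *: repr x).

Let pi_eq a b : a - b \in gen_ideal rels -> \pi_Q a = \pi_Q b.
Proof. by move=> Iab; apply/eqP; rewrite -Quotient.idealrBE. Qed.

Let repr_pi a : repr (\pi_Q a) - a \in gen_ideal rels.
Proof. by rewrite Quotient.idealrBE reprK. Qed.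

Let idealM a b :
  a \in gen_ideal rels -> b * a \in gen_ideal rels /\ a * b \in gen_ideal rels.
Proof. by have [_ h] := gen_ideal_closed rels; apply: h. Qed.

Let piM a b : \pi_Q (a * b) = presented_mul (\pi_Q a) (\pi_Q b).
Proof.
apply/esym/pi_eq; set a' := repr _; set b' := repr _.
have -> : a' * b' - a * b = a' * (b' - b) + (a' - a) * b.
  by rewrite mulrBr mulrBl addrA subrK.
by rewrite rpredD // ?(idealM _ (repr_pi _)).1 ?(idealM _ (repr_pi _)).2.
Qed.

Let piZ c a : \pi_Q (c *: a) = presented_scale c (\pi_Q a).
Proof.
apply/esym/pi_eq; rewrite -scalerBr -[X in c *: X]mul1r scalerAl.
exact: (idealM _ (repr_pi _)).1.
Qed.

Let piD a b : \pi_Q (a + b) = \pi_Q a + \pi_Q b.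
Proof. by rewrite !piE. Qed.

Let mulA : associative presented_mul.
Proof.
elim/quotW=> a; elim/quotW=> b; elim/quotW=> c.
by rewrite -(piM b) -(piM a) -(piM a b) -(piM _ c) mulrA.
Qed.

Let mul1 : left_id presented_one presented_mul.
Proof. by elim/quotW=> a; rewrite -piM mul1r. Qed.

Let mulr1 : right_id presented_one presented_mul.
Proof. by elim/quotW=> a; rewrite -piM mulr1. Qed.

Let mulDl : left_distributive presented_mul +%R.
Proof.
elim/quotW=> a; elim/quotW=> b; elim/quotW=> c.
by rewrite -piD -(piM _ c) -(piM a) -(piM b) -piD mulrDl.
Qed.

Let mulDr : right_distributive presented_mul +%R.
Proof.
elim/quotW=> a; elim/quotW=> b; elim/quotW=> c.
by rewrite -piD -(piM a _) -(piM a b) -(piM a c) -piD mulrDr.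
Qed.

Let one_neq0 : presented_one != 0.
Proof.
apply/eqP => one0; have: 1 - 0 \in gen_ideal rels.
  by rewrite Quotient.idealrBE -/Q; apply/eqP; rewrite -/presented_one one0 !piE.
by rewrite subr0 (negPf proper_rels).
Qed.

HB.instance Definition _ := GRing.Zmodule_isNzRing.Build presented
  mulA mul1 mulr1 mulDl mulDr one_neq0.

Let scaleA c d x : presented_scale c (presented_scale d x) = presented_scale (c * d) x.
Proof. by elim/quotW: x => a; rewrite -(piZ d) -(piZ c) -piZ scalerA. Qed.

Let scale1 : left_id 1 presented_scale.
Proof. by elim/quotW=> a; rewrite -piZ scale1r. Qed.

Let scaleDr : right_distributive presented_scale +%R.
Proof.
move=> c; elim/quotW=> a; elim/quotW=> b.
by rewrite -piD -(piZ c _) -(piZ c a) -(piZ c b) -piD scalerDr.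
Qed.

Let scaleDl x : {morph presented_scale^~ x : c d / c + d}.
Proof. by elim/quotW: x => a c d; rewrite -(piZ _ a) -(piZ c) -(piZ d) -piD scalerDl. Qed.

HB.instance Definition _ := GRing.Zmodule_isLmodule.Build k presented
  scaleA scale1 scaleDr scaleDl.

Let scaleAl (c : k) (x y : presented) : c *: (x * y) = c *: x * y.
Proof.
elim/quotW: x => a; elim/quotW: y => b.
change (presented_scale c (presented_mul (\pi_Q a) (\pi_Q b)) = presented_mul (presented_scale c (\pi_Q a)) (\pi_Q b)).
by rewrite -(piM a b) -(piZ c a) -(piZ c) -(piM _ b) scalerAl.
Qed.

HB.instance Definition _ := GRing.Lmodule_isLalgebra.Build k presented scaleAl.

Let scaleAr (c : k) (x y : presented) : c *: (x * y) = x * (c *: y).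
Proof.
elim/quotW: x => a; elim/quotW: y => b.
change (presented_scale c (presented_mul (\pi_Q a) (\pi_Q b)) = presented_mul (\pi_Q a) (presented_scale c (\pi_Q b))).
by rewrite -(piM a b) -(piZ c b) -(piZ c) -(piM a) scalerAr.
Qed.

HB.instance Definition _ := GRing.Lalgebra_isAlgebra.Build k presented scaleAr.

Definition presented_pi (a : A) : presented := \pi_Q a.

Let pi_is_zmod_morphism : zmod_morphism presented_pi.
Proof. by move=> a b; rewrite /presented_pi !piE. Qed.

Let pi_is_monoid_morphism : monoid_morphism presented_pi.
Proof. by split=> // a b; apply: piM. Qed.

HB.instance Definition _ := GRing.isZmodMorphism.Build
  A presented presented_pi pi_is_zmod_morphism.
HB.instance Definition _ := GRing.isMonoidMorphism.Build
  A presented presented_pi pi_is_monoid_morphism.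
HB.instance Definition _ := GRing.isScalable.Build
  k A presented *:%R presented_pi piZ.

Lemma presented_pi_eq0 a : (presented_pi a == 0) = (a \in gen_ideal rels).
Proof. by rewrite -(rmorph0 presented_pi) -[a in RHS]subr0 Quotient.idealrBE. Qed.

Lemma presented_pi_surj (x : presented) : exists a, x = presented_pi a.
Proof. by elim/quotW: x => a; exists a. Qed.

End Presented.

Inductive letter := X1 | X2 | U1 | U2 | G | Zeta.

Definition nat_of_letter l :=
  match l with X1 => 0 | X2 => 1 | U1 => 2 | U2 => 3 | G => 4 | Zeta => 5 end%N.

Definition letter_of_nat n :=
  nth None [:: Some X1; Some X2; Some U1; Some U2; Some G; Some Zeta] n.

Lemma nat_of_letterK : pcancel nat_of_letter letter_of_nat.
Proof. by case. Qed.

HB.instance Definition _ := Countable.copy letter (pcan_type nat_of_letterK).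

Lemma malg_fmonom_scalerAr (k : comNzRingType) (I : choiceType) (c : k)
  (a b : {malg k[{fmonom I}]}) : c *: (a * b) = a * (c *: b).
Proof.
have comm_c : (c%:MP : {malg k[{fmonom I}]}) * a = a * c%:MP.
  rewrite mul_malgC malgZ_def malgM_def fgmulgU.
  by apply: eq_bigr => w _; rewrite mulm1 mulrC.
rewrite -!mul_malgC mulrA comm_c.
exact/esym/mulrA.
Qed.

(* The free algebra on the letters: the monoid algebra of the free monoid. *)
Definition free_alg (k : comNzRingType) : algType k :=
  HB.pack_for (algType k) {malg k[{fmonom letter}]}
    (GRing.Lalgebra_isAlgebra.Build k {malg k[{fmonom letter}]}
      (@malg_fmonom_scalerAr k letter)).

Section Relations.
Variables (A : pzRingType) (v : letter -> A) (p : nat).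

Local Notation x1 := (v X1).
Local Notation x2 := (v X2).
Local Notation u1 := (v U1).
Local Notation u2 := (v U2).
Local Notation g := (v G).
Local Notation zeta := (v Zeta).
Local Notation x21 := (x2 * x1 + x1 * x2).
Local Notation u21 := (u1 * u2 + u2 * u1).

Definition double_rels : seq (A * A) :=
  [:: (x1 ^+ 2, 0);
      (x2 * x21, x21 * x2 + x1 * x21);
      (x21 ^+ p, 0);
      (x2 ^+ (2 * p), 0);
      (u1 ^+ 2, 0);
      (u2 * u21, u21 * u2 + u1 * u21);
      (u21 ^+ p, 0);
      (u2 ^+ (2 * p), 0);
      (zeta ^+ p, zeta);
      (g ^+ p, 1);
      (zeta * g, g * zeta);
      (zeta * x1, x1 * zeta + x1);
      (zeta * x2, x2 * zeta + x2);
      (u1 * zeta, zeta * u1 + u1);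
      (u2 * zeta, zeta * u2 + u2);
      (g * x1, x1 * g);
      (g * x2, (x2 - x1) * g);
      (u1 * g, g * u1);
      (u2 * g, g * u2 - g * u1);
      (u1 * x1, - (x1 * u1));
      (u1 * x2, - (x2 * u1) + (1 - g));
      (u2 * x1, - (x1 * u2) + (1 - g) + x1 * u1);
      (u2 * x2, - (x2 * u2) + g * zeta + x2 * u1)].

End Relations.

Lemma double_rels_counit (A k : pzRingType) (v : letter -> A) (p : nat)
    (f : {rmorphism A -> k}) l r :
    (0 < p)%N -> (forall i, f (v i) = (i == G)%:R) ->
  (l, r) \in double_rels v p -> f l = f r.
Proof.
move=> p_gt0 fv; have p2_gt0 : (0 < 2 * p)%N by rewrite muln_gt0.
suff /allP rels0 : all (fun r => f r.1 == f r.2) (double_rels v p).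
  by move=> /rels0/eqP.
rewrite /double_rels /=.
rewrite !(rmorphD, rmorphN, rmorphM, rmorphXn, rmorph1, rmorph0) !fv /=.
rewrite !(mulr0, mul0r, mulr1, addr0, oppr0, subrr) /=.
by rewrite !expr0n !expr1n (gtn_eqF p_gt0) (gtn_eqF p2_gt0) !eqxx.
Qed.

Section FreeAlgebra.
Variable k : comNzRingType.

Definition var (l : letter) : free_alg k := << fmu l >>.

(* The algebra morphism free_alg k -> k sending g to 1 and the other letters
   to 0; it shows that the algebra presented by double_rels is nonzero. *)
Definition counit_monom (w : {fmonom letter}) : k := (all (pred1 G) w)%:R.

Let counit_monom_mmorphism : mmorphism counit_monom.
Proof.
split=> [w1 w2|]; rewrite /counit_monom ?fm1 //.
by rewrite fmM all_cat -natrM mulnb.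
Qed.

HB.instance Definition _ :=
  monalg.isMultiplicative.Build {fmonom letter} k counit_monom
    counit_monom_mmorphism.

Definition counit : {rmorphism free_alg k -> k} := mmap idfun counit_monom.

Lemma counit_var l : counit (var l) = (l == G)%:R.
Proof. by rewrite /= mmapU mul1r /counit_monom fmU /= andbT. Qed.

Lemma double_rels_proper p : (0 < p)%N -> 1 \notin gen_ideal (double_rels var p).
Proof.
move=> p_gt0; apply/negP => I1.
have: counit 1 = 0.
  by apply: gen_ideal_ker I1 => l r; apply: double_rels_counit counit_var.
by rewrite rmorph1; apply/eqP/oner_neq0.
Qed.

End FreeAlgebra.

(* Locked so that terms about the algebra never unfold to the free algebra. *)
Definition double_alg (k : comNzRingType) (p : nat) (pcharkp : p \in [pchar k]) :
    algType k :=
  locked (presented (double_rels_proper k (prime_gt0 (pcharf_prime pcharkp)))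
          : algType k).

Arguments double_alg {k p} pcharkp.

Lemma double_algE (k : comNzRingType) (p : nat) (pcharkp : p \in [pchar k]) :
  double_alg pcharkp =
  presented (double_rels_proper k (prime_gt0 (pcharf_prime pcharkp))).
Proof. by rewrite /double_alg -lock. Qed.

Section Modules.
Variables (k : fieldType) (A : algType k).

Definition simple_module (M : lmodType A) : Prop :=
  (exists m : M, m != 0) /\
  (forall N : {pred M}, submod_closed N ->
     (forall m, m \in N -> m = 0) \/ (forall m, m \in N)).

Definition isomorphic_modules (M N : lmodType A) : Prop :=
  exists f : {linear M -> N}, bijective f.

(* M has a k-basis with n elements; k acts on M through c |-> c%:A. *)
Definition has_kdim (M : lmodType A) (n : nat) : Prop :=
  exists b : 'I_n -> M, forall m,
    exists! c : 'rV[k]_n, m = \sum_(i < n) (c 0 i)%:A *: b i.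

End Modules.

(* Main.v *)
Require Import Defs.
From mathcomp Require Import all_boot all_order all_algebra.
From HB Require Import structures.
From mathcomp Require Import boolp monalg ring.

Set Implicit Arguments.
Unset Strict Implicit.
Unset Printing Implicit Defensive.

Import GRing.Theory.
Local Open Scope ring_scope.

(** The reason behind the result: the subalgebra generated by x1, x21, u1, u21
    and g is normal, and it is local with residue field k, because its
    generators commute or anticommute pairwise and x1, x21, u1, u21, g - 1 are
    nilpotent. On every nonzero module these five elements have a common
    kernel, which is a submodule ([inv_normal_ex], [inv_normal_stable]); a
    simple module is therefore equal to it ([simple_inv_normal]). So a simple
    module is a simple module over the quotient of the algebra by x1, u1 and
    g - 1, a restricted form of osp(1|2): there x2 and u2 are odd, satisfy
    x2 u2 + u2 x2 = zeta, and raise and lower by one the weight, that is the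
    eigenvalue of zeta.

    The rest is highest weight theory. Since u2 is nilpotent and zeta is
    diagonalizable with eigenvalues in the prime field, a simple module
    contains v != 0 with u2 v = 0 and zeta v = - m v for some m < p. With
    e_j = x2^j v one has u2 e_j = c_j e_(j-1), where c_0 = 0 and
    c_(j+1) = j - m - c_j, hence c_(2i) = i and c_(2i+1) = i - m ([ladder]).
    The first index j > 0 with c_j = 0 is 2m + 1. The vectors e_j with
    j > 2m span a proper submodule, so they vanish by simplicity, and
    e_0, ..., e_(2m) is a basis ([simple_osp_module]). Conversely the same
    formulas define matrices of size 2m + 1 satisfying all the relations
    ([osp_module_ex]), and the nonvanishing of c_1, ..., c_(2m) makes the
    resulting module simple ([module_simple]). Its isomorphism class depends
    on m only ([module_iso]) and determines m, by the order of nilpotency of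
    x2 ([module_iso_inj]). *)

(** * Presentation and universal property *)

Lemma map_double_rels (A B : pzRingType) (f : {rmorphism A -> B})
    (v : letter -> A) (w : letter -> B) p :
    (forall l, f (v l) = w l) ->
  double_rels w p = [seq (f r.1, f r.2) | r <- double_rels v p].
Proof.
move=> fv; rewrite /double_rels /=.
by rewrite !(rmorphD, rmorphN, rmorphM, rmorphXn, rmorph1, rmorph0) /= !fv.
Qed.

Section FreeAlgebra.
Variable k : comNzRingType.

(** Being generated by the letters is recorded as an induction principle, so
    that it can be transported to quotients and used with arbitrary
    predicates. *)
Lemma free_alg_ind (P : free_alg k -> Prop) :
    (forall c, P c%:A) -> (forall a b, P a -> P b -> P (a + b)) ->
    (forall a b, P a -> P b -> P (a * b)) -> (forall l, P (var k l)) ->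
  forall a, P a.
Proof.
move=> PC PD PM Pv a.
have P0 : P 0 by rewrite -[0](scale0r 1); exact: PC.
have PU (s : seq letter) : P (<< FMonom s >> : {malg k[{fmonom letter}]}).
  elim: s => [|l s IHs].
    rewrite (_ : << FMonom [::] >> = 1%:A :> free_alg k); first exact: PC.
    by rewrite scale1r -fmoneE.
  rewrite (_ : << FMonom (l :: s) >> = var k l * (<< FMonom s >> : free_alg k)).
    exact: PM.
  rewrite [RHS](fgmulUU 1 1 (fmu l) (FMonom s)) mulr1; congr << _ >>.
  by apply/eqP; rewrite fmP fmM fmU.
rewrite (monalgE (a : {malg k[{fmonom letter}]})).
elim/big_ind: _ => // w _.
rewrite (_ : << _ *g w >> = (a@_w)%:A * (<< w >> : free_alg k)).
  by apply: PM; [exact: PC | case: w].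
rewrite -scalerAl mul1r -[RHS](mul_malgC a@_w (<< w >> : {malg k[_]})).
by rewrite [RHS](fgmulUU a@_w 1 mone w) mulr1 mul1m.
Qed.

Section Universal.
Variables (B : algType k) (w : letter -> B).

Definition word_val (s : {fmonom letter}) : B :=
  \prod_(l <- (s : seq letter)) w l.

Fact word_val_mmorphism : mmorphism word_val.
Proof.
split=> [s t|]; rewrite /word_val ?fm1 ?big_nil //.
by rewrite fmM big_cat.
Qed.
HB.instance Definition _ :=
  monalg.isMultiplicative.Build {fmonom letter} B word_val word_val_mmorphism.

Definition free_lift : free_alg k -> B := mmap (in_alg B) word_val.

Fact free_lift_zmod_morphism : zmod_morphism free_lift.
Proof. exact: mmap_is_additive. Qed.
Fact free_lift_monoid_morphism : monoid_morphism free_lift.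
Proof.
have [fM f1] : multiplicative free_lift; last by [].
apply: commr_mmap_is_multiplicative => g m m'.
by rewrite /GRing.comm /= mulr_algl mulr_algr.
Qed.
Fact free_lift_scalable : scalable free_lift.
Proof. by move=> c a; rewrite /free_lift mmapZ /= mulr_algl. Qed.

HB.instance Definition _ :=
  GRing.isZmodMorphism.Build (free_alg k) B free_lift free_lift_zmod_morphism.
HB.instance Definition _ :=
  GRing.isMonoidMorphism.Build (free_alg k) B free_lift
    free_lift_monoid_morphism.
HB.instance Definition _ :=
  GRing.isScalable.Build k (free_alg k) B *:%R free_lift free_lift_scalable.

Lemma free_lift_var l : free_lift (var k l) = w l.
Proof.
rewrite /free_lift /var mmapU /= scale1r mul1r /word_val.
by rewrite fmU big_seq1.
Qed.
End Universal.
End FreeAlgebra.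

Section PresentedLift.
Variables (k : comNzRingType) (A : algType k) (rels : seq (A * A)).
Hypothesis proper_rels : 1 \notin gen_ideal rels.
Variables (B : algType k) (f : {lrmorphism A -> B}).
Hypothesis f_rels : forall l r, (l, r) \in rels -> f l = f r.

Local Notation Q := (presented proper_rels).
Local Notation pi := (presented_pi proper_rels).

Lemma presented_lift_ker a b : pi a = pi b -> f a = f b.
Proof.
move=> eq_ab; apply/eqP; rewrite -subr_eq0 -rmorphB; apply/eqP.
apply: gen_ideal_ker f_rels _.
by rewrite -(presented_pi_eq0 proper_rels) rmorphB /= eq_ab subrr.
Qed.

(** The lift is computed on chosen preimages; [presented_lift_ker] makes it
    independent of the choice. *)
Lemma presented_lift_ex :
  exists h : {lrmorphism Q -> B}, forall a, h (pi a) = f a.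
Proof.
have pi_ex (x : Q) : exists a, x == pi a.
  by have [a ->] := presented_pi_surj x; exists a.
pose F (x : Q) := f (xchoose (pi_ex x)).
have FE a : F (pi a) = f a.
  by apply: presented_lift_ker; rewrite -(eqP (xchooseP (pi_ex (pi a)))).
have Fadd : zmod_morphism F.
  move=> x y; have [a ->] := presented_pi_surj x.
  by have [b ->] := presented_pi_surj y; rewrite -rmorphB !FE rmorphB.
have Fmul : monoid_morphism F.
  split=> [|x y]; first by rewrite -(rmorph1 pi) FE rmorph1.
  have [a ->] := presented_pi_surj x.
  by have [b ->] := presented_pi_surj y; rewrite -rmorphM !FE rmorphM.
have Fscale : scalable F.
  move=> c x; have [a ->] := presented_pi_surj x.
  by rewrite -linearZ !FE linearZ.
pose addF := GRing.isZmodMorphism.Build Q B F Fadd.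
pose mulF := GRing.isMonoidMorphism.Build Q B F Fmul.
pose scF := GRing.isScalable.Build k Q B *:%R F Fscale.
pose h : {lrmorphism Q -> B} := HB.pack F addF mulF scF.
by exists h.
Qed.
End PresentedLift.

(** All that is used later about the algebra: relations, generation and
    universal property. Working with an abstract A keeps the quotient
    construction out of the terms. *)
Record double_presentation (k : comNzRingType) (p : nat) (A : algType k)
    (X : letter -> A) : Prop := DoublePresentation {
  double_relP : forall l r, (l, r) \in double_rels X p -> l = r;
  double_ind : forall P : A -> Prop,
    (forall c, P c%:A) -> (forall a b, P a -> P b -> P (a + b)) ->
    (forall a b, P a -> P b -> P (a * b)) -> (forall l, P (X l)) ->
    forall a, P a;
  double_lift : forall (B : algType k) (w : letter -> B),
    (forall l r, (l, r) \in double_rels w p -> l = r) ->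
    exists f : {lrmorphism A -> B}, forall l, f (X l) = w l
}.

Lemma double_alg_presentation (k : comNzRingType) (p : nat)
    (pcharkp : p \in [pchar k]) :
  exists X : letter -> double_alg pcharkp, double_presentation p X.
Proof.
rewrite double_algE; set proper := double_rels_proper _ _.
pose pi := presented_pi proper; exists (fun l => pi (var k l)).
have eqX := @map_double_rels _ _ pi (var k) _ p (fun=> erefl).
split.
- move=> l r; rewrite eqX => /mapP[[a b] rel_ab [-> ->]]; apply/eqP => /=.
  by rewrite -subr_eq0 -rmorphB presented_pi_eq0 mem_gen_ideal.
- move=> P PC PD PM PX x; have [a ->] := presented_pi_surj x.
  elim/free_alg_ind: a => [c|a b|a b|l].
  + by rewrite linearZ /= rmorph1.
  + by rewrite rmorphD; exact: PD.
  + by rewrite rmorphM; exact: PM.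
  + exact: PX.
- move=> B w w_rels.
  have [|h hE] := @presented_lift_ex _ _ _ proper _ (free_lift w).
    move=> l r rel_lr; apply: w_rels.
    rewrite (@map_double_rels _ _ (free_lift w) (var k)); last exact: free_lift_var.
    by apply/mapP; exists (l, r).
  by exists h => l; rewrite hE /= free_lift_var.
Qed.

(** * Subspaces of modules and kernels of nilpotent elements *)
Section KSubspaces.
Variables (k : fieldType) (A : algType k).
Implicit Types (M : lmodType A) (a b : A) (c : k).

Lemma scale_algC M a c (m : M) : a *: (c%:A *: m) = c%:A *: (a *: m).
Proof. by rewrite !scalerA mulr_algr mulr_algl. Qed.

Lemma scale_algA M c d (m : M) : c%:A *: (d%:A *: m) = (c * d)%:A *: m.
Proof. by rewrite scalerA -scalerAl mul1r scalerA. Qed.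

Definition ksubspace M (P : M -> Prop) : Prop :=
  [/\ P 0, forall u v, P u -> P v -> P (u + v)
    & forall c u, P u -> P (c%:A *: u)].

(** Defining the span as an intersection makes stability under an operator a
    matter of checking it on the generators, without finite sums. *)
Definition kspan M (E : nat -> M) (w : M) : Prop :=
  forall P : M -> Prop, ksubspace P -> (forall j, P (E j)) -> P w.

Lemma kspan_mem M (E : nat -> M) j : kspan E (E j).
Proof. by move=> P _; apply. Qed.

Lemma ksubspace_kspan M (E : nat -> M) : ksubspace (kspan E).
Proof.
split=> [P [P0 _ _] _ | u v Eu Ev P subP PE | c u Eu P subP PE] //.
  by have [_ PD _] := subP; apply: PD; [apply: Eu | apply: Ev].
by have [_ _ PZ] := subP; apply: PZ; apply: Eu.
Qed.

Lemma ksubspace_preim M (P : M -> Prop) a :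
  ksubspace P -> ksubspace (fun w => P (a *: w)).
Proof.
move=> [P0 PD PZ]; split=> [|u v|c u]; first by rewrite scaler0.
  by rewrite scalerDr; apply: PD.
by rewrite scale_algC; apply: PZ.
Qed.

Lemma ksubspace_ker M a : ksubspace (fun w : M => a *: w = 0).
Proof.
apply: (@ksubspace_preim M (fun w => w = 0) a).
by split=> [|u v -> ->|c u ->]; rewrite ?addr0 ?scaler0.
Qed.

Lemma kspan_stable M (E : nat -> M) a :
  (forall j, kspan E (a *: E j)) -> forall w, kspan E w -> kspan E (a *: w).
Proof.
move=> Ea w Ew; apply: (Ew (fun u => kspan E (a *: u))) => //.
exact/ksubspace_preim/ksubspace_kspan.
Qed.

(** Apply the factors of the product one after the other, starting with the
    last: the first one that kills the vector reached so far gives the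
    kernel element. This yields both eigenvectors (linear factors of an
    annihilating polynomial) and kernels of nilpotent elements (constant
    sequences). *)
Lemma prod_kernel M (P : M -> Prop) (s : seq A) (m : M) :
    P m -> m != 0 -> (forall a, a \in s -> forall u, P u -> P (a *: u)) ->
    \prod_(a <- s) a *: m = 0 ->
  exists2 a, a \in s & exists w : M, [/\ P w, w != 0 & a *: w = 0].
Proof.
elim/last_ind: s m => [|s a IHs] m Pm m_neq0 Ps.
  by rewrite big_nil scale1r => m0; rewrite m0 eqxx in m_neq0.
rewrite big_rcons /= -scalerA => sam0.
have [am0|am_neq0] := eqVneq (a *: m) 0.
  by exists a; [rewrite mem_rcons mem_head | exists m].
have [||b bs [w Hw]] := IHs (a *: m) _ am_neq0 _ sam0.
- by apply: Ps; rewrite // mem_rcons mem_head.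
- by move=> b bs; apply: Ps; rewrite mem_rcons inE bs orbT.
by exists b; [rewrite mem_rcons inE bs orbT | exists w].
Qed.

Lemma nilpotent_kernel M (P : M -> Prop) a n (m : M) :
    P m -> m != 0 -> (forall u, P u -> P (a *: u)) -> a ^+ n = 0 ->
  exists w : M, [/\ P w, w != 0 & a *: w = 0].
Proof.
move=> Pm m0 Pa an0.
have [||_ /nseqP[-> _] //] := @prod_kernel M P (nseq n a) m Pm m0.
  by move=> _ /nseqP[-> _].
by rewrite big_nseq iter_mulr_1 an0 scale0r.
Qed.

End KSubspaces.

(** * The prime field and the ladder coefficients *)
Section PrimeSubfield.
Variables (k : fieldType) (p : nat).
Hypothesis pcharkp : p \in [pchar k].

Lemma natr_inj i j : (i < p)%N -> (j < p)%N -> i%:R = j%:R :> k -> i = j.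
Proof.
wlog le_ij : i j / (i <= j)%N.
  by move=> IH lt_i lt_j eq_ij; case/orP: (leq_total i j) => /IH-> //.
move=> _ lt_j /eqP; rewrite eq_sym -subr_eq0 -natrB // -(dvdn_pcharf pcharkp).
rewrite /dvdn modn_small; last exact: leq_ltn_trans (leq_subr _ _) lt_j.
by rewrite subn_eq0 => le_ji; apply/eqP; rewrite eqn_leq le_ij.
Qed.

Lemma prime_subfield_pow i j : (i%:R - j%:R : k) ^+ p = i%:R - j%:R.
Proof. by rewrite -(pFrobenius_autE pcharkp) rmorphB !rmorph_nat. Qed.

(** The roots are written as opposites because the lowest weights that occur
    below are the - m. *)
Lemma prime_subfield_poly :
  'X^p - 'X = \prod_(i <- iota 0 p) ('X - (- i%:R)%:P) :> {poly k}.
Proof.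
have p_gt1 := prime_gt1 (pcharf_prime pcharkp).
rewrite -(big_map (fun i => - i%:R) predT (fun z : k => 'X - z%:P)).
have size_f : size ('X^p - 'X : {poly k}) = p.+1.
  by rewrite size_polyDl size_polyXn // size_polyN size_polyX.
rewrite [LHS](@all_roots_prod_XsubC _ _ [seq - i%:R | i <- iota 0 p]).
- by rewrite /lead_coef size_f coefB coefXn coefX eqxx gtn_eqF // subr0 scale1r.
- by rewrite size_map size_iota size_f.
- apply/allP => _ /mapP[i _ ->]; rewrite rootE !hornerE.
  by rewrite -[- i%:R]sub0r (prime_subfield_pow 0 i) subrr.
- rewrite uniq_rootsE map_inj_in_uniq ?iota_uniq // => i j.
  rewrite !mem_iota !add0n => /andP[_ lt_i] /andP[_ lt_j] /oppr_inj.
  exact: natr_inj lt_i lt_j.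
Qed.

(** The coefficients of u2 along the powers of x2 on a vector v with u2 v = 0
    and zeta v = - m v: the recursion is u2 x2 = zeta - x2 u2. *)
Fixpoint ladder m j : k :=
  if j is i.+1 then i%:R - m%:R - ladder m i else 0.

Lemma ladderS m j : ladder m j.+1 = j%:R - m%:R - ladder m j.
Proof. by []. Qed.

Lemma ladder_double m i :
  ladder m i.*2 = i%:R /\ ladder m i.*2.+1 = i%:R - m%:R.
Proof.
elim: i => [|i [IH0 IH1]]; first by rewrite ladderS subr0.
have IH2 : ladder m i.+1.*2 = i.+1%:R.
  by rewrite doubleS ladderS IH1 -addnn -!natr1 natrD; ring.
by split=> //; rewrite ladderS IH2 doubleS -addnn -!natr1 natrD; ring.
Qed.

Lemma ladder_top m : ladder m (2 * m).+1 = 0.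
Proof. by rewrite mul2n (ladder_double m m).2 subrr. Qed.

Lemma ladder_neq0 m j : (m < p)%N -> (0 < j <= 2 * m)%N -> ladder m j != 0.
Proof.
move=> lt_mp; rewrite -[j]odd_double_half; set i := j./2.
have [E0 E1] := ladder_double m i; case: (odd j); rewrite ?add0n ?add1n mul2n.
  rewrite ltn_double E1 subr_eq0 => lt_im; apply: contraTneq (lt_im) => eq_im.
  by rewrite (natr_inj (ltn_trans lt_im lt_mp) lt_mp eq_im) ltnn.
rewrite double_gt0 leq_double E0 => /andP[i_gt0 le_im]; apply: contraTneq i_gt0.
have p_gt0 := leq_ltn_trans (leq0n m) lt_mp.
by move/(@natr_inj i 0 (leq_ltn_trans le_im lt_mp) p_gt0)->.
Qed.

End PrimeSubfield.

(** * Invariants of the normal subalgebra *)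
Section DoubleModules.
Variables (k : fieldType) (p : nat).
Hypothesis pcharkp : p \in [pchar k].
Variables (A : algType k) (X : letter -> A).
Hypothesis presX : double_presentation p X.
Implicit Types (M N : lmodType A) (c : k).

Local Notation x1 := (X X1).
Local Notation x2 := (X X2).
Local Notation u1 := (X U1).
Local Notation u2 := (X U2).
Local Notation g := (X G).
Local Notation zeta := (X Zeta).

Lemma submodule_ind M (P : M -> Prop) :
    ksubspace P -> (forall l u, P u -> P (X l *: u)) ->
  forall a u, P u -> P (a *: u).
Proof.
move=> [P0 PD PZ] PX.
elim/(double_ind presX) => [c u|a b Pa Pb u|a b Pa Pb u|l u] Pu.
- exact: PZ.
- by rewrite scalerDl; apply: PD; [apply: Pa | apply: Pb].
- by rewrite -scalerA; apply: Pa; apply: Pb.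
- exact: PX.
Qed.

Lemma simple_submodule M (P : M -> Prop) (m : M) :
    simple_module M -> ksubspace P -> (forall l u, P u -> P (X l *: u)) ->
    m != 0 -> P m ->
  forall w, P w.
Proof.
move=> [_ simM] subP PX m_neq0 Pm w.
pose N : {pred M} := fun w => `[< P w >].
have [|N0|Nall] := simM N; last exact/asboolP/(Nall w).
- have [P0 PD _] := subP; split; first exact/asboolP.
  move=> a u v /asboolP Pu /asboolP Pv; apply/asboolP; apply: PD => //.
  exact: submodule_ind.
- by move: m_neq0; rewrite (N0 m) ?eqxx //; apply/asboolP.
Qed.

(** A relation is designated by its position in [double_rels]. *)
Let relE n : (n < 23)%N ->
  (nth (0, 0) (double_rels X p) n).1 = (nth (0, 0) (double_rels X p) n).2.
Proof.
move=> lt_n; apply: (double_relP presX); rewrite -surjective_pairing.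
exact: mem_nth.
Qed.

Let x1_sqr : x1 ^+ 2 = 0. Proof. exact: (relE (n := 0)). Qed.
Let x21_nil : (x2 * x1 + x1 * x2) ^+ p = 0. Proof. exact: (relE (n := 2)). Qed.
Lemma x2_nil : x2 ^+ (2 * p) = 0. Proof. exact: (relE (n := 3)). Qed.
Let u1_sqr : u1 ^+ 2 = 0. Proof. exact: (relE (n := 4)). Qed.
Let u21_nil : (u1 * u2 + u2 * u1) ^+ p = 0. Proof. exact: (relE (n := 6)). Qed.
Lemma u2_nil : u2 ^+ (2 * p) = 0. Proof. exact: (relE (n := 7)). Qed.
Lemma zeta_pow : zeta ^+ p = zeta. Proof. exact: (relE (n := 8)). Qed.
Let g_p : g ^+ p = 1. Proof. exact: (relE (n := 9)). Qed.

Section Actions.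
Variable M : lmodType A.
Implicit Type m : M.

Let relation_actionE n m : (n < 23)%N ->
  (nth (0, 0) (double_rels X p) n).1 *: m
    = (nth (0, 0) (double_rels X p) n).2 *: m.
Proof. by move=> /relE->. Qed.

Ltac relation_action n m :=
  have /= := @relation_actionE n m isT;
  rewrite ?(mulrBl, scalerDl, scalerBl, scaleNr, scale1r) -!scalerA.

Let zeta_g m : zeta *: (g *: m) = g *: (zeta *: m).
Proof. by relation_action 10%N m. Qed.
Let zeta_x1 m : zeta *: (x1 *: m) = x1 *: (zeta *: m) + x1 *: m.
Proof. by relation_action 11%N m. Qed.
Lemma zeta_x2 m : zeta *: (x2 *: m) = x2 *: (zeta *: m) + x2 *: m.
Proof. by relation_action 12%N m. Qed.
Let u1_zeta m : u1 *: (zeta *: m) = zeta *: (u1 *: m) + u1 *: m.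
Proof. by relation_action 13%N m. Qed.
Lemma u2_zeta m : u2 *: (zeta *: m) = zeta *: (u2 *: m) + u2 *: m.
Proof. by relation_action 14%N m. Qed.
Let g_x1 m : g *: (x1 *: m) = x1 *: (g *: m).
Proof. by relation_action 15%N m. Qed.
Let g_x2 m : g *: (x2 *: m) = x2 *: (g *: m) - x1 *: (g *: m).
Proof. by relation_action 16%N m. Qed.
Let u1_g m : u1 *: (g *: m) = g *: (u1 *: m).
Proof. by relation_action 17%N m. Qed.
Let u2_g m : u2 *: (g *: m) = g *: (u2 *: m) - g *: (u1 *: m).
Proof. by relation_action 18%N m. Qed.
Let u1_x1 m : u1 *: (x1 *: m) = - (x1 *: (u1 *: m)).
Proof. by relation_action 19%N m. Qed.
Let u1_x2 m : u1 *: (x2 *: m) = - (x2 *: (u1 *: m)) + (m - g *: m).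
Proof. by relation_action 20%N m. Qed.
Let u2_x1 m :
  u2 *: (x1 *: m) = - (x1 *: (u2 *: m)) + (m - g *: m) + x1 *: (u1 *: m).
Proof. by relation_action 21%N m. Qed.
Lemma u2_x2 m :
  u2 *: (x2 *: m) = - (x2 *: (u2 *: m)) + g *: (zeta *: m) + x2 *: (u1 *: m).
Proof. by relation_action 22%N m. Qed.
Let x1_x1 m : x1 *: (x1 *: m) = 0.
Proof. by rewrite scalerA -expr2 x1_sqr scale0r. Qed.
Let u1_u1 m : u1 *: (u1 *: m) = 0.
Proof. by rewrite scalerA -expr2 u1_sqr scale0r. Qed.

(** The invariants of the normal subalgebra are reached in three steps. On
    vectors killed by x1, the element x21 acts as x1 x2; on vectors killed
    by u1, the element u21 acts as u1 u2. This is why x21 and u21 do not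
    appear in the next two definitions. *)
Definition inv_x1u1g m := [/\ x1 *: m = 0, u1 *: m = 0 & g *: m = m].
Definition inv_x21 m := inv_x1u1g m /\ x1 *: (x2 *: m) = 0.
Definition inv_normal m := inv_x21 m /\ u1 *: (u2 *: m) = 0.

Lemma inv_x1u1g_ex m : m != 0 -> exists m', m' != 0 /\ inv_x1u1g m'.
Proof.
move=> m_neq0.
have [w [_ w_neq0 w1]] :=
  nilpotent_kernel (P := fun _ => True) I m_neq0 (fun _ => id) x1_sqr.
have [|v [v1 v_neq0 v2]] :=
  nilpotent_kernel (P := fun m => x1 *: m = 0) w1 w_neq0 _ u1_sqr.
  by move=> m' m'0; apply: oppr_inj; rewrite -u1_x1 m'0 scaler0 oppr0.
(* In characteristic p, the relation g^p = 1 says that g - 1 is nilpotent. *)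
have pcharA : p \in [pchar A] by exact: (rmorph_pchar (in_alg A)).
have gB1 : (g - 1) ^+ p = 0.
  rewrite -(pFrobenius_autE pcharA) (pFrobenius_autB_comm _ (commr1 g)).
  by rewrite pFrobenius_aut1 pFrobenius_autE g_p subrr.
have [||n [[n1 n2] n_neq0 n3]] := nilpotent_kernel
  (P := fun m => x1 *: m = 0 /\ u1 *: m = 0) _ v_neq0 _ gB1; first by [].
  move=> m' [m'1 m'2]; rewrite scalerBl scale1r !scalerBr -g_x1 u1_g m'1 m'2.
  by rewrite scaler0 subrr.
exists n; split=> //; split=> //; apply/eqP; rewrite -subr_eq0.
by rewrite -[X in _ - X]scale1r -scalerBl n3.
Qed.

Let x1_u2 m : inv_x1u1g m -> x1 *: (u2 *: m) = 0.
Proof.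
move=> [m1 m2 m3]; have := u2_x1 m; rewrite m1 m2 m3 !scaler0 subrr !addr0.
by move/eqP; rewrite eq_sym oppr_eq0 => /eqP.
Qed.

Let g_u2 m : inv_x1u1g m -> g *: (u2 *: m) = u2 *: m.
Proof. by move=> [_ m2 m3]; have := u2_g m; rewrite m2 m3 scaler0 subr0. Qed.

Let u1_x2K m : inv_x1u1g m -> u1 *: (x2 *: m) = 0.
Proof. by move=> [m1 m2 m3]; rewrite u1_x2 m2 m3 scaler0 subrr oppr0 addr0. Qed.

Let g_x2K m : inv_x1u1g m -> g *: (x2 *: m) = x2 *: m.
Proof. by move=> [m1 m2 m3]; rewrite g_x2 m3 m1 subr0. Qed.

Let inv_x1u1g_zeta m : inv_x1u1g m -> inv_x1u1g (zeta *: m).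
Proof.
move=> [m1 m2 m3]; split.
- have := zeta_x1 m; rewrite m1 scaler0 addr0 => <- //.
- by rewrite u1_zeta m2 scaler0 addr0.
- by rewrite -zeta_g m3.
Qed.

Let inv_x21_x2 m : inv_x21 m -> inv_x1u1g (x2 *: m).
Proof. by move=> [inv1m m4]; split; [|exact: u1_x2K|exact: g_x2K]. Qed.

Let inv_normal_u2_x1u1g m : inv_normal m -> inv_x1u1g (u2 *: m).
Proof. by move=> [[inv1m _] m4]; split; [exact: x1_u2| |exact: g_u2]. Qed.

Let x1_x2_u2 m : inv_x21 m -> x1 *: (x2 *: (u2 *: m)) = 0.
Proof.
move=> inv2m; have [inv1m m4] := inv2m; have [m1 m2 m3] := inv1m.
have [z1 z2 z3] := inv_x1u1g_zeta inv1m.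
have := u2_x2 m; rewrite m2 scaler0 addr0 z3 => /(congr1 (fun w => x1 *: w)).
rewrite (x1_u2 (inv_x21_x2 inv2m)) scalerDr scalerN z1 addr0.
by move/eqP; rewrite eq_sym oppr_eq0 => /eqP.
Qed.

(** The kernel of x21 is taken inside the vectors fixed by x1, u1 and g, which
    it preserves since it commutes with these elements. *)
Lemma inv_x21_ex m : m != 0 -> exists m', m' != 0 /\ inv_x21 m'.
Proof.
move=> /inv_x1u1g_ex[v [v_neq0 inv1v]].
have [|w [inv1w w_neq0]] :=
  nilpotent_kernel (P := inv_x1u1g) inv1v v_neq0 _ x21_nil.
  move=> w inv1w; have [w1 w2 w3] := inv1w.
  rewrite scalerDl -!scalerA w1 scaler0 add0r; split; first exact: x1_x1.
    by rewrite u1_x1 u1_x2K // scaler0 oppr0.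
  by rewrite g_x1 g_x2K.
have [w1 _ _] := inv1w.
by rewrite scalerDl -!scalerA w1 scaler0 add0r => w4; exists w.
Qed.

Lemma inv_normal_ex m : m != 0 -> exists m', m' != 0 /\ inv_normal m'.
Proof.
move=> /inv_x21_ex[v [v_neq0 inv2v]].
have [|w [inv2w w_neq0]] :=
  nilpotent_kernel (P := inv_x21) inv2v v_neq0 _ u21_nil.
  move=> w inv2w; have [inv1w w4] := inv2w; have [w1 w2 w3] := inv1w.
  rewrite scalerDl -!scalerA w2 scaler0 addr0; split; first split.
  - by apply: oppr_inj; rewrite -u1_x1 x1_u2 // scaler0 oppr0.
  - exact: u1_u1.
  - by rewrite -u1_g g_u2.
  have := u1_x2 (u2 *: w); rewrite g_u2 // subrr addr0.
  move/(congr1 (fun w => x1 *: w)); rewrite scalerN => /(congr1 -%R).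
  rewrite opprK => <-; have := u1_x1 (x2 *: (u2 *: w)).
  by rewrite x1_x2_u2 // scaler0.
have [[_ w2 _] _] := inv2w.
by rewrite scalerDl -!scalerA w2 scaler0 addr0 => w5; exists w.
Qed.

Let inv_normal_zeta m : inv_normal m -> inv_normal (zeta *: m).
Proof.
move=> [[inv1m m4] m5]; split; first split.
- exact: inv_x1u1g_zeta.
- have := zeta_x2 m; move/(congr1 (fun w => x1 *: w)).
  rewrite scalerDr m4 addr0 => <-.
  by have := zeta_x1 (x2 *: m); rewrite m4 scaler0 addr0.
- have := u2_zeta m; move/(congr1 (fun w => u1 *: w)) => ->.
  by rewrite scalerDr u1_zeta m5 scaler0 !addr0.
Qed.

Let inv_normal_x2 m : inv_normal m -> inv_normal (x2 *: m).
Proof.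
move=> inv3m; have [inv2m m5] := inv3m; have [inv1m m4] := inv2m.
have [m1 m2 m3] := inv1m.
split; first split.
- exact: inv_x21_x2.
(* The relation x2 x21 = x21 x2 + x1 x21 shows that x21 kills x2 m. *)
- have := @relation_actionE 1 m isT; rewrite /= !(scalerDl, =^~ scalerA).
  by rewrite m1 m4 !scaler0 !addr0 !scaler0 add0r addr0 => <-.
- have [z1 z2 z3] := inv_x1u1g_zeta inv1m.
  have [_ w2 w3] := inv_normal_u2_x1u1g inv3m.
  rewrite u2_x2 m2 z3 scaler0 addr0 scalerDr scalerN z2 addr0.
  by rewrite u1_x2K ?oppr0 //; exact: inv_normal_u2_x1u1g.
Qed.

Let inv_normal_u2 m : inv_normal m -> inv_normal (u2 *: m).
Proof.
move=> inv3m; have [inv2m m5] := inv3m; have [inv1m m4] := inv2m.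
have [m1 m2 m3] := inv1m.
split; first split.
- exact: inv_normal_u2_x1u1g.
- exact: x1_x2_u2.
(* The relation u2 u21 = u21 u2 + u1 u21 shows that u21 kills u2 m. *)
- have := @relation_actionE 5 m isT; rewrite /= !(scalerDl, =^~ scalerA).
  by rewrite m2 m5 !scaler0 !addr0 !scaler0 addr0 => <-.
Qed.

(** Each commutator or anticommutator of a generator with x1, x21, u1, u21 or
    g - 1 lies in the left ideal generated by these five elements. *)
Lemma inv_normal_stable l m : inv_normal m -> inv_normal (X l *: m).
Proof.
move=> inv3m; have [[[m1 m2 m3] _] _] := inv3m.
have inv0 : inv_normal 0 by split; [split; [split|]|]; rewrite ?scaler0.
case: l; rewrite ?(m1, m2, m3) //.
- exact: inv_normal_x2.
- exact: inv_normal_u2.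
- exact: inv_normal_zeta.
Qed.

Lemma ksubspace_inv_normal : ksubspace inv_normal.
Proof.
split.
- by split; [split; [split|]|]; rewrite ?scaler0.
- move=> u v [[[a1 a2 a3] a4] a5] [[[b1 b2 b3] b4] b5].
  split; [split; [split|]|]; rewrite !scalerDr ?(a1, a2, a3, a4, a5);
    by rewrite ?(b1, b2, b3, b4, b5) ?addr0.
- move=> c u [[[a1 a2 a3] a4] a5].
  split; [split; [split|]|]; rewrite !scale_algC;
    by rewrite ?(a1, a2, a3, a4, a5) ?scaler0.
Qed.

Lemma simple_inv_normal : simple_module M -> forall m, inv_normal m.
Proof.
move=> simM; have [[m m_neq0] _] := simM.
have [v [v_neq0 inv3v]] := inv_normal_ex m_neq0.
exact: simple_submodule ksubspace_inv_normal inv_normal_stable v_neq0 inv3v.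
Qed.

End Actions.

(** * Weight modules of the quotient osp(1|2) *)

(** The family is indexed by all of nat, and in a finite-dimensional module it
    is continued by zero, so that no formula needs a side condition; at j = 0
    the coefficient of u2 is zero and the value of j.-1 is immaterial. *)
Record osp_chain m M (e : nat -> M) : Prop := OspChain {
  chain_x1 : forall j, x1 *: e j = 0;
  chain_u1 : forall j, u1 *: e j = 0;
  chain_g : forall j, g *: e j = e j;
  chain_x2 : forall j, x2 *: e j = e j.+1;
  chain_u2 : forall j, u2 *: e j = (ladder k m j)%:A *: e j.-1;
  chain_zeta : forall j, zeta *: e j = (j%:R - m%:R)%:A *: e j
}.

Record osp_module m M (e : nat -> M) : Prop := OspModule {
  module_chain : osp_chain m e;
  module_bottom : e 0%N != 0;
  module_top : e (2 * m).+1 = 0;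
  module_span : forall w, kspan e w
}.

Section Chains.
Variables (m : nat) (M : lmodType A) (e : nat -> M).
Hypothesis chain_e : osp_chain m e.

(** Going down from index s is prevented by the vanishing of the coefficient of
    u2 there. The case s = 0 gives the whole span, the case s = 2m + 1 the
    kernel of the projection of a Verma module to its simple quotient. *)
Lemma tail_stable s : ladder k m s = 0 ->
  let tail i := e (s + i)%N in
  forall l w, kspan tail w -> kspan tail (X l *: w).
Proof.
move=> s0 tail l; have [P0 PD PZ] := ksubspace_kspan tail.
have tail_mem i : kspan tail (e (s + i)%N) by move=> P _; apply.
apply: kspan_stable => j; case: l.
- by rewrite (chain_x1 chain_e).
- by rewrite (chain_x2 chain_e) -addnS; exact: tail_mem.
- by rewrite (chain_u1 chain_e).
- rewrite (chain_u2 chain_e); case: j => [|j].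
    by rewrite addn0 s0 !scale0r.
  by rewrite addnS; apply: PZ; exact: tail_mem.
- by rewrite (chain_g chain_e); exact: tail_mem.
- by rewrite (chain_zeta chain_e); apply: PZ; exact: tail_mem.
Qed.

Lemma chain_stable l w : kspan e w -> kspan e (X l *: w).
Proof. exact: (@tail_stable 0). Qed.

Lemma chain_x2X r j : x2 ^+ r *: e j = e (r + j)%N.
Proof.
elim: r => [|r IHr]; first by rewrite scale1r.
by rewrite exprS -scalerA IHr (chain_x2 chain_e).
Qed.

Lemma chain_u2X_lt r j : (j < r)%N -> u2 ^+ r *: e j = 0.
Proof.
elim: r j => // r IHr j.
rewrite exprSr -scalerA (chain_u2 chain_e) scale_algC ltnS.
by case: j => [|j] lt_j; [rewrite !scale0r | rewrite IHr // scaler0].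
Qed.

Hypothesis lt_mp : (m < p)%N.

Lemma chain_u2X r : (r <= 2 * m)%N ->
  exists2 c, c != 0 & u2 ^+ r *: e r = c%:A *: e 0%N.
Proof.
elim: r => [|r IHr] le_r; first by exists 1; rewrite ?oner_neq0 // !scale1r.
have [c c_neq0 IH] := IHr (ltnW le_r); exists (ladder k m r.+1 * c).
  by rewrite mulf_neq0 // (ladder_neq0 pcharkp).
by rewrite exprSr -scalerA (chain_u2 chain_e) scale_algC IH scale_algA.
Qed.

(** The operator u2 ^+ n kills e_j for j < n and sends e_n to a nonzero
    multiple of e_0, so the leading coefficient of an element of P has to
    vanish. With P zero this is linear independence, with P a submodule
    this is simplicity. *)
Lemma chain_coef_eq0 (P : M -> Prop) n (a : nat -> k) :
    ksubspace P -> (forall w, P w -> P (u2 *: w)) -> ~ P (e 0%N) ->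
    (n <= (2 * m).+1)%N -> P (\sum_(j < n) (a j)%:A *: e j) ->
  forall j, (j < n)%N -> a j = 0.
Proof.
move=> [_ _ PZ] Pu2 nPe0; elim: n => // n IHn le_n.
rewrite big_ord_recr /= => Psum.
have Pu2X r w : P w -> P (u2 ^+ r *: w).
  move=> Pw; elim: r => [|r IHr]; first by rewrite scale1r.
  by rewrite exprS -scalerA; exact: Pu2.
have [c c_neq0 u2n] := chain_u2X le_n.
have an0 : a n = 0.
  apply/eqP/negPn/negP => an_neq0; apply: nPe0.
  have := Pu2X n _ Psum.
  rewrite scalerDr scaler_sumr big1 => [|j _]; last first.
    by rewrite scale_algC chain_u2X_lt // scaler0.
  rewrite add0r scale_algC u2n => /(PZ (a n * c)^-1).
  by rewrite !scale_algA -mulrA mulVf ?mulf_neq0 // !scale1r.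
move: Psum; rewrite an0 !scale0r addr0 => /(IHn (ltnW le_n)) a0 j.
by rewrite ltnS leq_eqVlt => /predU1P[-> // | /a0].
Qed.

End Chains.

Section OspModules.
Variables (m : nat) (lt_mp : (m < p)%N).

Section OneModule.
Variables (M : lmodType A) (e : nat -> M).
Hypothesis osp_e : osp_module m e.
Let chain_e := module_chain osp_e.

Lemma module_ind (P : M -> Prop) :
  ksubspace P -> (forall j, P (e j)) -> forall w, P w.
Proof. by move=> subP Pe w; apply: (module_span osp_e w). Qed.

Lemma module_tail j : ((2 * m).+1 <= j)%N -> e j = 0.
Proof.
by move=> /subnK<-; rewrite -(chain_x2X chain_e) (module_top osp_e) scaler0.
Qed.

Lemma module_coord w :
  exists a : nat -> k, w = \sum_(j < (2 * m).+1) (a j)%:A *: e j.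
Proof.
elim/module_ind: w.
  split=> [|u v [a ->] [b ->]|c u [a ->]].
  - by exists (fun=> 0); rewrite big1 // => j _; rewrite !scale0r.
  - exists (fun j => a j + b j); rewrite -big_split; apply: eq_bigr => j _.
    by rewrite !scalerDl.
  - exists (fun j => c * a j); rewrite scaler_sumr; apply: eq_bigr => j _.
    by rewrite scale_algA.
move=> j; have [/module_tail->|lt_j] := leqP (2 * m).+1 j.
  by exists (fun=> 0); rewrite big1 // => i _; rewrite !scale0r.
exists (fun i => (i == j)%:R); rewrite (bigD1 (Ordinal lt_j)) //= eqxx !scale1r.
rewrite big1 ?addr0 // => i; rewrite -val_eqE /= => /negPf->.
by rewrite !scale0r.
Qed.

Lemma module_free (a b : nat -> k) :
    \sum_(j < (2 * m).+1) (a j)%:A *: e j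
      = \sum_(j < (2 * m).+1) (b j)%:A *: e j ->
  forall j, (j < (2 * m).+1)%N -> a j = b j.
Proof.
move=> eq_ab j lt_j; apply/eqP; rewrite -subr_eq0; apply/eqP; move: j lt_j.
apply: (chain_coef_eq0 chain_e lt_mp
         (P := fun w => w = 0) (a := fun j => a j - b j)) => //.
- by split=> [|u v -> ->|c u ->]; rewrite ?addr0 ?scaler0.
- by move=> w ->; rewrite scaler0.
- by apply/eqP; exact: module_bottom osp_e.
- under eq_bigr do rewrite !scalerBl.
  by rewrite sumrB eq_ab subrr.
Qed.

Lemma module_simple : simple_module M.
Proof.
split; first by exists (e 0%N); exact: module_bottom osp_e.
move=> N [N0 NL]; have subN : ksubspace (fun w => w \in N).
  split=> // [u v Nu Nv | c u Nu]; first by rewrite -[u]scale1r NL.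
  by rewrite -[_ *: u]addr0 NL.
have NX a w : w \in N -> a *: w \in N by move=> Nw; rewrite -[_ *: w]addr0 NL.
have [Ne0|nNe0] := boolP (e 0%N \in N); [right=> w | left=> w Nw].
  elim/module_ind: w => // j.
  by rewrite -[j]addn0 -(chain_x2X chain_e) NX.
have [a def_w] := module_coord w; rewrite def_w big1 // => j _.
rewrite (chain_coef_eq0 chain_e lt_mp (P := fun w => w \in N)
           (n := (2 * m).+1) (a := a)) ?scale0r //.
- exact: NX.
- exact/negP.
- by rewrite -def_w.
Qed.

Lemma module_kdim : has_kdim M (2 * m).+1.
Proof.
exists (fun i => e i) => w; have [a def_w] := module_coord w.
exists (\row_i a i); split=> [|c def_c].
  by rewrite [LHS]def_w; apply: eq_bigr => i _; rewrite mxE.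
apply/rowP => i; rewrite mxE.
pose b j := c 0 (inord j).
rewrite (_ : c 0 i = b i); last by rewrite /b inord_val.
apply: module_free => //; rewrite -def_w [LHS]def_c.
by apply: eq_bigr => j _; rewrite /b inord_val.
Qed.

(** This invariant recovers m from the isomorphism class. *)
Lemma module_x2X n : (forall w : M, x2 ^+ n *: w = 0) <-> (2 * m < n)%N.
Proof.
split=> [x2n0 | lt_n w].
  rewrite ltnNge; apply/negP => le_n.
  have [c c_neq0 u2n] := chain_u2X chain_e lt_mp le_n.
  have en0 : e n = 0 by rewrite -[n]addn0 -(chain_x2X chain_e) x2n0.
  have /eqP := u2n; rewrite en0 scaler0 eq_sym => /eqP ce0.
  have /eqP := congr1 (fun w => c^-1%:A *: w) ce0.
  rewrite scaler0 scale_algA mulVf // !scale1r.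
  exact/negP/(module_bottom osp_e).
elim/module_ind: w => [|j]; first exact: ksubspace_ker.
by rewrite (chain_x2X chain_e) module_tail // ltn_addr.
Qed.

End OneModule.

Lemma module_lift M N (e : nat -> M) (e' : nat -> N) :
    osp_module m e -> osp_module m e' ->
  exists f : {linear M -> N}, forall j, f (e j) = e' j.
Proof.
move=> osp_e osp_e'; pose n := (2 * m).+1.
have [a def_a] := choice (module_coord osp_e).
pose f w := \sum_(j < n) (a w j)%:A *: e' j.
(* Linear independence makes f independent of the choice of coordinates. *)
have fE (b : nat -> k) :
    f (\sum_(j < n) (b j)%:A *: e j) = \sum_(j < n) (b j)%:A *: e' j.
  apply: eq_bigr => j _; congr (_%:A *: _).
  by apply: (module_free osp_e (a := a _) (b := b)) => //; rewrite -def_a.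
have fD u v : f (u + v) = f u + f v.
  rewrite [in LHS](def_a u) [in LHS](def_a v) -big_split /= -big_split /=.
  under eq_bigr do rewrite -!scalerDl.
  rewrite (fE (fun j => a u j + a v j)).
  by apply: eq_bigr => j _; rewrite !scalerDl.
have fZ c u : f (c%:A *: u) = c%:A *: f u.
  rewrite [in LHS](def_a u) !scaler_sumr.
  under eq_bigr do rewrite scale_algA.
  rewrite (fE (fun j => c * a u j)).
  by apply: eq_bigr => j _; rewrite scale_algA.
have f0 : f 0 = 0.
  by rewrite -[0](scale0r 0) -[X in X *: _](scale0r 1) fZ !scale0r.
have fe j : f (e j) = e' j.
  have [le_j|lt_j] := leqP n j.
    by rewrite (module_tail osp_e) ?(module_tail osp_e').
  have eE (V : lmodType A) (E : nat -> V) :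
      \sum_(i < n) (i == j :> nat)%:R%:A *: E i = E j.
    rewrite (bigD1 (Ordinal lt_j)) //= eqxx !scale1r big1 ?addr0 // => i.
    by rewrite -val_eqE /= => /negPf->; rewrite !scale0r.
  by rewrite -[e j]eE (fE (fun i => (i == j)%:R)) eE.
have fX l w : f (X l *: w) = X l *: f w.
  elim/(module_ind osp_e): w.
    split=> [|u v fu fv|c u fu]; first by rewrite scaler0 f0 scaler0.
      by rewrite !(fD, scalerDr) fu fv.
    by rewrite scale_algC !fZ fu scale_algC.
  move=> j; have [chE chE'] := (module_chain osp_e, module_chain osp_e').
  case: l; rewrite ?fe.
  - by rewrite (chain_x1 chE) (chain_x1 chE') f0.
  - by rewrite (chain_x2 chE) (chain_x2 chE') fe.
  - by rewrite (chain_u1 chE) (chain_u1 chE') f0.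
  - by rewrite (chain_u2 chE) (chain_u2 chE') fZ fe.
  - by rewrite (chain_g chE) (chain_g chE') fe.
  - by rewrite (chain_zeta chE) (chain_zeta chE') fZ fe.
have fA b : forall w, f (b *: w) = b *: f w.
  elim/(double_ind presX): b => [c w|b c fb fc w|b c fb fc w|l w].
  - exact: fZ.
  - by rewrite !scalerDl fD fb fc.
  - by rewrite -!scalerA fb fc.
  - exact: fX.
have f_linear : linear f by move=> b u v; rewrite fD fA.
pose isLf := GRing.isLinear.Build A M N *:%R f f_linear.
pose F : {linear M -> N} := HB.pack f isLf.
by exists F.
Qed.

Lemma module_iso M N (e : nat -> M) (e' : nat -> N) :
  osp_module m e -> osp_module m e' -> isomorphic_modules M N.
Proof.
move=> osp_e osp_e'; have [f fe] := module_lift osp_e osp_e'.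
have [h he] := module_lift osp_e' osp_e.
have lift_id (V : lmodType A) (E : nat -> V) (q : {linear V -> V}) :
    osp_module m E -> (forall j, q (E j) = E j) -> forall w, q w = w.
  move=> osp_E qE w; elim/(module_ind osp_E): w => //.
  split=> [|u v qu qv|c u qu]; first exact: linear0.
    by rewrite linearD qu qv.
  by rewrite linearZ /= qu.
exists f; exists h => w.
  by apply: (lift_id _ e (h \o f : {linear M -> M})) => // j /=; rewrite fe he.
by apply: (lift_id _ e' (f \o h : {linear N -> N})) => // j /=; rewrite he fe.
Qed.

End OspModules.

Lemma module_iso_inj m n M N (e : nat -> M) (e' : nat -> N) :
    (m < p)%N -> (n < p)%N -> osp_module m e -> osp_module n e' ->
  isomorphic_modules M N -> m = n.
Proof.
move=> lt_mp lt_np osp_e osp_e' [f [h fK hK]].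
have x2X r :
    (forall w : M, x2 ^+ r *: w = 0) <-> (forall w : N, x2 ^+ r *: w = 0).
  split=> x2r w; first by rewrite -[w]hK -linearZ x2r linear0.
  by apply: (can_inj fK); rewrite linearZ /= x2r linear0.
have le_mn : (2 * n < (2 * m).+1)%N.
  by apply/(module_x2X lt_np osp_e')/x2X/(module_x2X lt_mp osp_e).
have le_nm : (2 * m < (2 * n).+1)%N.
  by apply/(module_x2X lt_mp osp_e)/x2X/(module_x2X lt_np osp_e').
apply/eqP; rewrite eqn_leq; move: le_mn le_nm.
by rewrite !ltnS !leq_pmul2l // => -> ->.
Qed.

(** * Classification of the simple modules *)
Lemma prod_zeta : \prod_(a <- [seq zeta + i%:R%:A | i <- iota 0 p]) a = 0.
Proof.
have /(congr1 (horner_alg zeta)) := prime_subfield_poly pcharkp.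
rewrite rmorphB rmorphXn rmorph_prod /= horner_algX zeta_pow subrr.
rewrite big_map => ->; apply: eq_bigr => i _.
by rewrite rmorphB /= horner_algX horner_algC scaleNr opprK.
Qed.

(** The kernel of u2 is nonzero as u2 is nilpotent, and stable under zeta,
    which is annihilated by a product of linear factors. *)
Lemma singular_vector_ex (M : lmodType A) (v0 : M) : v0 != 0 ->
  exists (v : M) m,
    [/\ (m < p)%N, v != 0, u2 *: v = 0 & zeta *: v = (- m%:R)%:A *: v].
Proof.
move=> v0_neq0.
have [w [_ w_neq0 u2w]] :=
  nilpotent_kernel (P := fun=> True) I v0_neq0 (fun _ => id) u2_nil.
have [| |a] := prod_kernel (P := fun u : M => u2 *: u = 0) u2w w_neq0
  (s := [seq zeta + i%:R%:A | i <- iota 0 p]).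
- move=> _ /mapP[i _ ->] u u2u.
  by rewrite scalerDl scalerDr scale_algC u2_zeta u2u !scaler0 !addr0.
- by rewrite prod_zeta scale0r.
move=> /mapP[m]; rewrite mem_iota add0n => /andP[_ lt_mp] ->.
move=> [v [u2v v_neq0 /eqP]].
rewrite scalerDl addr_eq0 => /eqP zeta_v.
by exists v, m; rewrite scaleNr scaleNr.
Qed.

Lemma simple_osp_module (M : lmodType A) : simple_module M ->
  exists m (e : nat -> M), (m < p)%N /\ osp_module m e.
Proof.
move=> simM; have invM := simple_inv_normal simM.
have [[v0 v0_neq0] _] := simM.
have [v [m [lt_mp v_neq0 u2v zeta_v]]] := singular_vector_ex v0_neq0.
pose e j := x2 ^+ j *: v; exists m, e; split=> //.
have x2e j : x2 *: e j = e j.+1 by rewrite scalerA -exprS.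
have x2eX r j : x2 ^+ r *: e j = e (r + j)%N by rewrite scalerA -exprD.
have zeta_e j : zeta *: e j = (j%:R - m%:R)%:A *: e j.
  elim: j => [|j IHj]; first by rewrite /e !scale1r zeta_v sub0r.
  rewrite -x2e zeta_x2 IHj !scale_algC -[X in _ + X]scale1r.
  by rewrite -[X in _ + X *: _]scale1r -!scalerDl -natr1 addrAC.
have chain_e : osp_chain m e.
  split=> // j; have [[[e1 e2 e3] _] _] := invM (e j) => //.
  elim: j {e1 e2 e3} => [|j IHj]; first by rewrite /e !scale1r u2v !scale0r.
  have [[[_ u1e _] _] _] := invM (e j).
  have [[[_ _ ge] _] _] := invM (zeta *: e j).
  rewrite -[in LHS]x2e u2_x2 u1e ge scaler0 addr0 zeta_e IHj scale_algC.
  have -> : (ladder k m j)%:A *: (x2 *: e j.-1) = (ladder k m j)%:A *: e j.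
    by case: j {IHj u1e ge} => [|j]; rewrite ?scale0r // x2e.
  by rewrite -scaleNr -scalerDl -scaleNr -scalerDl ladderS addrC.
have e0_neq0 : e 0%N != 0 by rewrite /e scale1r.
have span_e : forall w, kspan e w.
  apply: (simple_submodule simM (ksubspace_kspan e) _ e0_neq0).
    exact: chain_stable chain_e.
  exact: (@kspan_mem _ _ _ e 0%N).
split=> //; apply/eqP/negPn/negP => top_neq0.
(* It remains to see that e_(2m+1) = 0. Otherwise the tail spans M; but x2^d,
   with e_d the last nonzero vector, kills the tail and not e_0. *)
pose tail i := e ((2 * m).+1 + i)%N.
have tail_all w : kspan tail w.
  have tail0 : kspan tail (e (2 * m).+1).
    by rewrite -[(2 * m).+1]addn0; exact: (@kspan_mem _ _ _ tail).
  apply: (simple_submodule simM (ksubspace_kspan tail) _ top_neq0 tail0).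
  exact: (tail_stable chain_e (ladder_top k m)).
have [d [ed_neq0 eSd]] : exists d, e d != 0 /\ e d.+1 = 0.
  have: e (2 * p)%N = 0 by rewrite /e x2_nil scale0r.
  elim: (2 * p)%N => [e0|d IHd eSd]; first by rewrite e0 eqxx in e0_neq0.
  by have [/IHd|ed] := eqVneq (e d) 0; last by exists d.
move: ed_neq0; rewrite -[d]addn0 -x2eX; apply/negP/negPn/eqP.
apply: (tail_all (e 0%N) (fun w => x2 ^+ d *: w = 0)).
  exact: ksubspace_ker.
move=> j; have -> : tail j = x2 ^+ (2 * m + j) *: e 1%N.
  by rewrite x2eX /tail addn1 addSn.
by rewrite scalerA -exprD addnC exprD -scalerA x2eX addn1 eSd scaler0.
Qed.

End DoubleModules.

(** * Construction of the simple modules *)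
Section MatrixModule.
Variables (k : fieldType) (A : algType k) (n : nat).

Definition matrix_module of {lrmorphism A -> 'M[k]_n.+1} : Type := 'cV[k]_n.+1.

Variable rho : {lrmorphism A -> 'M[k]_n.+1}.
HB.instance Definition _ := GRing.Zmodule.copy (matrix_module rho) 'cV[k]_n.+1.

Definition matrix_action (a : A) (v : matrix_module rho) : matrix_module rho :=
  rho a *m v.

Let actA a b v : matrix_action a (matrix_action b v) = matrix_action (a * b) v.
Proof. by rewrite /matrix_action mulmxA rmorphM. Qed.
Let act1 : left_id 1 matrix_action.
Proof. by move=> v; rewrite /matrix_action rmorph1 mul1mx. Qed.
Let actDr : right_distributive matrix_action +%R.
Proof. by move=> a u v; rewrite /matrix_action mulmxDr. Qed.
Let actDl v : {morph matrix_action^~ v : a b / a + b}.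
Proof. by move=> a b; rewrite /matrix_action rmorphD mulmxDl. Qed.

HB.instance Definition _ :=
  GRing.Zmodule_isLmodule.Build A (matrix_module rho) actA act1 actDr actDl.

Lemma matrix_moduleE (a : A) (v : matrix_module rho) : a *: v = rho a *m v.
Proof. by []. Qed.

Lemma matrix_module_algE (c : k) (v : matrix_module rho) :
  c%:A *: v = (c *: (v : 'cV[k]_n.+1)) :> 'cV[k]_n.+1.
Proof. by rewrite matrix_moduleE linearZ /= rmorph1 -scalemxAl mul1mx. Qed.

End MatrixModule.

Section OspMatrices.
Variables (k : fieldType) (p : nat).
Hypothesis pcharkp : p \in [pchar k].
Variables (m : nat) (lt_mp : (m < p)%N).

Local Notation n := (2 * m)%N.
(** The index ranges over nat: columns past the end are zero, and the matrices
    below then act on all of them by the formulas of [osp_chain]. *)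
Definition unit_col j : 'cV[k]_n.+1 := \col_i (i == j :> nat)%:R.

Lemma unit_col_delta (i : 'I_n.+1) : unit_col i = delta_mx i 0.
Proof. by apply/matrixP => a b; rewrite !mxE ord1 eqxx andbT. Qed.

Lemma unit_col_oversize j : (n < j)%N -> unit_col j = 0.
Proof.
move=> lt_j; apply/matrixP => i b; rewrite !mxE; case: eqP => // ij.
by move: lt_j; rewrite -ij ltnNge -ltnS ltn_ord.
Qed.

Lemma matrix_unit_col (F : nat -> nat -> k) j :
  (\matrix_(i < n.+1, l < n.+1) F i l) *m unit_col j =
  if (j <= n)%N then \col_i F i j else 0.
Proof.
case: leqP => [le_j|/unit_col_oversize->]; last by rewrite mulmx0.
rewrite -[j]/(nat_of_ord (Ordinal (le_j : (j < n.+1)%N))) unit_col_delta -colE.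
by apply/matrixP => i b; rewrite !mxE.
Qed.

Lemma eq_unit_col (B C : 'M[k]_n.+1) :
  (forall j, B *m unit_col j = C *m unit_col j) -> B = C.
Proof.
move=> eqBC; apply/matrixP => i j.
by have /matrixP/(_ i 0) := eqBC j; rewrite unit_col_delta -!colE !mxE.
Qed.

Definition osp_x : 'M[k]_n.+1 := \matrix_(i, j) (i == j.+1 :> nat)%:R.
Definition osp_u : 'M[k]_n.+1 :=
  \matrix_(i, j) (ladder k m j * (i.+1 == j :> nat)%:R).
Definition osp_zeta : 'M[k]_n.+1 :=
  \matrix_(i, j) ((j%:R - m%:R) * (i == j :> nat)%:R).

Lemma osp_x_col j : osp_x *m unit_col j = unit_col j.+1.
Proof.
rewrite (matrix_unit_col (fun i j => (i == j.+1)%:R)).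
by case: leqP => // lt_j; rewrite unit_col_oversize // ltnW.
Qed.

(** At j = 2m + 1 the column on the left is zero and the one on the right is
    not: this is where the vanishing of the ladder at 2m + 1 is needed. *)
Lemma osp_u_col j : osp_u *m unit_col j = ladder k m j *: unit_col j.-1.
Proof.
rewrite (matrix_unit_col (fun i j => ladder k m j * (i.+1 == j)%:R)).
case: leqP => [_|]; last first.
  rewrite leq_eqVlt => /predU1P[<-|lt_j]; first by rewrite ladder_top scale0r.
  rewrite unit_col_oversize ?scaler0 // -ltnS prednK //.
  exact: leq_ltn_trans lt_j.
by case: j => [|j]; apply/matrixP => i b; rewrite !mxE ?mul0r.
Qed.

Lemma osp_zeta_col j : osp_zeta *m unit_col j = (j%:R - m%:R) *: unit_col j.
Proof.
rewrite (matrix_unit_col (fun i j => (j%:R - m%:R) * (i == j)%:R)).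
case: leqP => [_|lt_j]; last by rewrite unit_col_oversize ?scaler0.
by apply/matrixP => i b; rewrite !mxE.
Qed.

Definition osp_matrix l : 'M[k]_n.+1 :=
  match l with
  | X1 => 0 | X2 => osp_x | U1 => 0 | U2 => osp_u | G => 1 | Zeta => osp_zeta
  end.

Lemma osp_x_nil : osp_x ^+ (2 * p) = 0.
Proof.
have xX r j : osp_x ^+ r *m unit_col j = unit_col (r + j).
  by elim: r => [|r IHr]; rewrite ?mul1mx // exprS -mulmxA IHr osp_x_col.
apply: eq_unit_col => j; rewrite xX mul0mx unit_col_oversize //.
by rewrite ltn_addr // ltn_mul2l.
Qed.

Lemma osp_u_nil : osp_u ^+ (2 * p) = 0.
Proof.
have uX r j : (j < r)%N -> osp_u ^+ r *m unit_col j = 0.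
  elim: r j => // r IHr j; rewrite exprSr -mulmxA osp_u_col -scalemxAr ltnS.
  by case: j => [|j] lt_j; rewrite ?scale0r // IHr ?scaler0.
apply: eq_unit_col => j; rewrite mul0mx; have [|lt_j] := leqP j n.
  by move=> le_j; rewrite uX // (leq_ltn_trans le_j) // ltn_mul2l.
by rewrite unit_col_oversize // mulmx0.
Qed.

Lemma osp_zeta_pow : osp_zeta ^+ p = osp_zeta.
Proof.
have zX r j : osp_zeta ^+ r *m unit_col j = (j%:R - m%:R) ^+ r *: unit_col j.
  elim: r => [|r IHr]; first by rewrite mul1mx scale1r.
  by rewrite exprS -mulmxA IHr -scalemxAr osp_zeta_col scalerA mulrC exprS.
apply: eq_unit_col => j.
by rewrite zX osp_zeta_col (prime_subfield_pow pcharkp).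
Qed.

Lemma osp_zeta_x : osp_zeta * osp_x = osp_x * osp_zeta + osp_x.
Proof.
apply: eq_unit_col => j; rewrite mulmxDl -!mulmxA !(osp_x_col, osp_zeta_col).
rewrite -scalemxAr osp_x_col -[X in _ = _ + X]scale1r -scalerDl -natr1.
by congr (_ *: _); ring.
Qed.

Lemma osp_u_zeta : osp_u * osp_zeta = osp_zeta * osp_u + osp_u.
Proof.
apply: eq_unit_col => j; rewrite mulmxDl -!mulmxA !(osp_u_col, osp_zeta_col).
rewrite -!scalemxAr osp_u_col osp_zeta_col !scalerA -scalerDl.
case: j => [|j]; first by rewrite !(mulr0, mul0r) addr0.
by rewrite -natr1; congr (_ *: _); ring.
Qed.

Lemma osp_u_x : osp_u * osp_x = - (osp_x * osp_u) + osp_zeta.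
Proof.
apply: eq_unit_col => j; rewrite mulmxDl mulNmx -!mulmxA.
rewrite !(osp_x_col, osp_u_col, osp_zeta_col).
rewrite -scalemxAr osp_x_col; case: j => [|j].
  by rewrite /= subr0 scale0r oppr0 !add0r.
by rewrite -scaleNr -scalerDl ladderS addrC.
Qed.

Lemma osp_matrix_rels l r : (l, r) \in double_rels osp_matrix p -> l = r.
Proof.
have p_gt0 := prime_gt0 (pcharf_prime pcharkp).
suff /allP rels0 : all (fun r => r.1 == r.2) (double_rels osp_matrix p).
  by move=> /rels0/eqP.
rewrite /double_rels /=.
rewrite !(mul0r, mulr0, mul1r, mulr1, addr0, add0r, subr0, oppr0, subrr).
rewrite !expr0n expr1n /= (gtn_eqF p_gt0) osp_x_nil osp_u_nil osp_zeta_pow.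
by rewrite osp_zeta_x osp_u_zeta osp_u_x !eqxx.
Qed.

End OspMatrices.

Section OspExistence.
Variables (k : fieldType) (p : nat).
Hypothesis pcharkp : p \in [pchar k].
Variables (A : algType k) (X : letter -> A).
Hypothesis presX : double_presentation p X.

Lemma osp_module_ex m : (m < p)%N ->
  exists (L : lmodType A) (e : nat -> L), osp_module X m e.
Proof.
move=> lt_mp.
have [rho rhoE] := double_lift presX (osp_matrix_rels pcharkp lt_mp).
exists (matrix_module rho : lmodType A); exists (unit_col k m); split.
- split=> j; rewrite ?matrix_module_algE matrix_moduleE rhoE.
  + exact: mul0mx.
  + exact: mul0mx.
  + exact: mul1mx.
  + exact: osp_x_col.
  + exact: osp_u_col.
  + exact: osp_zeta_col.
- by apply/eqP => /matrixP/(_ 0 0)/eqP; rewrite !mxE oner_eq0.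
- exact: unit_col_oversize.
- move=> w P [P0 PD PZ] Pe.
  have -> : w = \sum_(i < (2 * m).+1) (w i 0) *: unit_col k m i.
    apply/matrixP => i j; rewrite ord1 summxE (bigD1 i) //= big1 => [|l].
      by rewrite !mxE eqxx mulr1 addr0.
    by rewrite !mxE eq_sym -val_eqE => /negPf /= ->; rewrite mulr0.
  elim/big_ind: _ => // i _.
  by rewrite -(matrix_module_algE (rho := rho)); exact: PZ.
Qed.
End OspExistence.

Theorem theorem4p7 (k : closedFieldType) (p : nat)
    (pcharkp : p \in [pchar k]) (p_gt2 : (2 < p)%N) :
  exists L : 'I_p -> lmodType (double_alg pcharkp),
    [/\ forall i, simple_module (L i),
        forall i, has_kdim (L i) (2 * i + 1)%N,
        forall i j, isomorphic_modules (L i) (L j) -> i = j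
      & forall M : lmodType (double_alg pcharkp), simple_module M ->
          exists i, isomorphic_modules M (L i)].
Proof.
have [X presX] := double_alg_presentation pcharkp.
have /choice[L L_osp] : forall i : 'I_p,
    exists L : lmodType (double_alg pcharkp),
    exists e : nat -> L, osp_module X i e.
  by move=> i; exact: (osp_module_ex pcharkp presX (ltn_ord i)).
exists L; split=> [i|i|i j isoL|M simM].
- have [e osp_e] := L_osp i; exact: (module_simple pcharkp (ltn_ord i) osp_e).
- have [e osp_e] := L_osp i; rewrite addn1.
  exact: (module_kdim pcharkp (ltn_ord i) osp_e).
- have [e osp_e] := L_osp i; have [e' osp_e'] := L_osp j.
  apply/val_inj; move: isoL.
  exact: (module_iso_inj pcharkp (ltn_ord i) (ltn_ord j) osp_e osp_e').
- have [m [e [lt_mp osp_e]]] := simple_osp_module pcharkp presX simM.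
  have [e' osp_e'] := L_osp (Ordinal lt_mp).
  exists (Ordinal lt_mp).
  exact: (module_iso pcharkp presX lt_mp osp_e osp_e').
Qed.
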